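(* Let $\Gamma$ be a countable discrete group with trivial amenable radical, and let $\Lambda\leq\Gamma$ be a co-amenable subgroup. Then a probability measure preserving action $\Gamma\curvearrowright(X,m)$ is essentially free if its restriction $\Lambda\curvearrowright(X,m)$ is essentially free.
   Context: The amenable radical is the maximal normal amenable subgroup. $\Lambda\leq\Gamma$ is co-amenable if every continuous affine action of $\Gamma$ on a non-empty compact convex set with a $\Lambda$-fixed point has a $\Gamma$-fixed point. An action of a group on $(X,m)$ is essentially free if $m(\{x:gx=x\})=0$ for every $g\neq e$ in the group. *)

(* Defs.v *)
From HB Require Import structures.
From mathcomp Require Import all_boot all_order all_algebra.
From mathcomp Require Import all_classical all_reals all_analysis.

Set Implicit Arguments.
Unset Strict Implicit.
Unset Printing Implicit Defensive.

Import Order.TTheory GRing.Theory Num.Theory.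
Import numFieldNormedType.Exports.

Local Open Scope classical_set_scope.
Local Open Scope ring_scope.

Definition is_subgroup (G : groupType) (H : set G) : Prop :=
  group_closed [in H].

Definition is_normal_subgroup (G : groupType) (N : set G) : Prop :=
  is_subgroup N /\ forall g x, N x -> N (x ^ g)%g.

(* Amenability of the subgroup [N] as a discrete group, in von Neumann's form:
   [N] carries a left-invariant finitely additive probability measure defined
   on all of its subsets. Values of [mu] on sets not included in [N] are
   irrelevant. *)
Definition amenable (R : realType) (G : groupType) (N : set G) : Prop :=
  exists mu : set G -> R,
    [/\ forall A, A `<=` N -> 0 <= mu A,
        mu N = 1,
        forall A B, A `<=` N -> B `<=` N -> A `&` B = set0 ->
          mu (A `|` B) = mu A + mu B
      & forall g A, N g -> A `<=` N -> mu [set (g * x)%g | x in A] = mu A].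

Definition is_amenable_radical (R : realType) (G : groupType) (N : set G) :
    Prop :=
  [/\ is_normal_subgroup N, amenable R N
    & forall M : set G, is_normal_subgroup M -> amenable R M -> M `<=` N].

(* Since [G] is discrete, continuity of the action means that every group
   element acts continuously. Values of [a g] outside [K] are irrelevant. *)
Record continuous_affine_action (R : realType) (G : groupType) (E : tvsType R)
    (K : set E) (a : G -> E -> E) : Prop := {
  affine_action_stable : forall g x, K x -> K (a g x) ;
  affine_action1 : forall x, K x -> a 1%g x = x ;
  affine_actionM : forall g h x, K x -> a (g * h)%g x = a g (a h x) ;
  affine_action_continuous : forall g, {within K, continuous (a g)} ;
  affine_action_affine : forall g x y (t : R), K x -> K y -> 0 <= t <= 1 ->
    a g (t *: x + (1 - t) *: y) = t *: a g x + (1 - t) *: a g y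
}.

Definition fixed_point (R : realType) (G : groupType) (E : tvsType R)
    (K : set E) (a : G -> E -> E) (H : set G) (x : E) : Prop :=
  K x /\ forall h, H h -> a h x = x.

(* Compact convex sets are taken, as usual, in Hausdorff locally convex
   topological vector spaces ([tvsType] includes local convexity). *)
Definition coamenable (R : realType) (G : groupType) (L : set G) : Prop :=
  forall (E : tvsType R) (K : set E) (a : G -> E -> E),
    hausdorff_space E -> K !=set0 -> compact K -> convex_set K ->
    continuous_affine_action K a ->
    (exists x, fixed_point K a L x) -> exists x, fixed_point K a [set: G] x.

Record pmp_action (R : realType) (G : groupType) (d : measure_display)
    (X : measurableType d) (m : probability X R) (act : G -> X -> X) : Prop := {
  pmp_action1 : forall x, act 1%g x = x ;
  pmp_actionM : forall g h x, act (g * h)%g x = act g (act h x) ;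
  pmp_action_measurable : forall g, measurable_fun [set: X] (act g) ;
  pmp_action_preserving : forall g A, measurable A ->
    m (act g @^-1` A) = m A
}.

Definition fixed_set (G : Type) (X : Type) (act : G -> X -> X) (g : G) : set X :=
  [set x | act g x = x].

Definition essentially_free (R : realType) (G : groupType)
    (d : measure_display) (X : measurableType d) (m : probability X R)
    (act : G -> X -> X) (H : set G) : Prop :=
  forall g, H g -> g <> 1%g -> m (fixed_set act g) = 0%E.

(* Fixed sets are automatically measurable when countably many measurable sets
   separate the points of [X], in particular on standard Borel spaces. *)
Lemma measurable_fixed_set (R : realType) (G : groupType)
    (d : measure_display) (X : measurableType d) (m : probability X R)
    (act : G -> X -> X) (B : nat -> set X) :
  pmp_action m act -> (forall n, measurable (B n)) ->
  (forall x y, (forall n, B n x <-> B n y) -> x = y) ->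
  forall g, measurable (fixed_set act g).
Proof.
move=> actP mB sepB g.
have -> : fixed_set act g =
    \bigcap_n ((act g @^-1` B n `&` B n) `|` (~` (act g @^-1` B n) `&` ~` B n)).
  apply/seteqP; split=> x /=; rewrite /fixed_set/=.
    move=> gx n _; case: (pselect (B n x)) => Bx; [left|right];
      by rewrite /setI /setC /= gx.
  move=> H; apply: sepB => n; have [[]|[]] /= := H n I; tauto.
have mg n : measurable (act g @^-1` B n).
  rewrite -[X in measurable X]setTI.
  exact: (pmp_action_measurable actP g).
apply: bigcap_measurable => [|n _]; first by exists 0%N.
by apply: measurableU; apply: measurableI => //; exact: measurableC.
Qed.

(* Main.v *)
(** Call mean a normalized positive functional on the bounded functions on
    [Gamma]. Co-amenability gives a [Gamma]-invariant mean [p] on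
    [Gamma / Lambda]. For almost every [x] the stabilizer of [x] acts freely on
    [Gamma / Lambda], hence there is a [Stab(x)]-equivariant map from
    [Gamma / Lambda] to [Stab(x)], chosen measurably in [x], and it carries [p]
    to a [Stab(x)]-invariant mean. Averaging over [x] gives a mean [mu] which,
    for every [g], dominates [m(Fix g)] times a [g]-invariant mean (average over
    [Fix g] only). The means with this property form a left ideal for
    convolution.
    Let [Q] be a minimal closed left ideal of means and [e] an extreme point of
    [Q]. By minimality [e] is the convolution of such a [mu] with an element of
    [Q], so when [m(Fix g) > 0] it is a convex combination of points of [Q] one
    of which is [g]-invariant; by extremality [e] is [g]-invariant. The normal
    subgroup generated by all these [g] fixes [e], so it is amenable, hence
    trivial. *)
From HB Require Import structures.
Require Import Defs.
From mathcomp Require Import all_boot all_order all_algebra.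
From mathcomp Require Import all_classical all_reals all_analysis.
From mathcomp Require Import ring lra.

Set Implicit Arguments.
Unset Strict Implicit.
Unset Printing Implicit Defensive.

Import Order.TTheory GRing.Theory Num.Theory.
Import numFieldNormedType.Exports.

Local Open Scope classical_set_scope.
Local Open Scope ring_scope.

(** * The topology of pointwise convergence *)

(** The locally convex space in which all means live. It is an alias of the product [R^I], so that
    it can be equipped with the [tvsType] structure that [coamenable] asks for. *)
Definition ptwise (R : realType) (I : Type) : Type :=
  prod_topology (fun _ : I => R^o).

Section ptwise_tvs.
Variables (R : realType) (I : Type).
Local Notation E := (ptwise R I).

HB.instance Definition _ := Uniform.copy E (prod_topology (fun _ : I => R^o)).
HB.instance Definition _ := GRing.Lmodule.copy E (I -> R^o).

Lemma ptwise_cvgP (F : set_system E) (x : E) : Filter F ->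
  F --> x <-> forall i, (fun f : E => f i) @ F --> (x i : R^o).
Proof.
move=> FF; rewrite cvg_sup; split=> Fx i.
  apply: cvg_trans (cvg_app _ (Fx i)) _.
  exact: initial_continuous.
move=> A [B [[C oC <-] Cx] CA]; apply: filterS CA _.
by apply: Fx; exact: open_nbhs_nbhs.
Qed.

Lemma ptwise_proj_continuous (i : I) : continuous (fun f : E => f i : R^o).
Proof. by move=> x; have /ptwise_cvgP := @cvg_id _ (nbhs x); apply. Qed.

Lemma ptwise_continuous (T : topologicalType) (f : T -> E) :
  (forall i, continuous (fun x => f x i : R^o)) -> continuous f.
Proof.
by move=> cf x; apply/ptwise_cvgP => i; exact: cf.
Qed.

Lemma ptwise_hausdorff : hausdorff_space E.
Proof. by apply: (@hausdorff_product {classic I}) => i; exact: Rhausdorff. Qed.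

Let ptwise_add_continuous : continuous (fun x : E * E => x.1 + x.2).
Proof.
apply: ptwise_continuous => i x.
have h1 : (fun x : E * E => x.1 i : R^o) @ x --> (x.1 i : R^o).
  apply: (@continuous_comp _ _ _ fst (fun f : E => f i : R^o)).
    exact: cvg_fst.
  exact: ptwise_proj_continuous.
have h2 : (fun x : E * E => x.2 i : R^o) @ x --> (x.2 i : R^o).
  apply: (@continuous_comp _ _ _ snd (fun f : E => f i : R^o)).
    exact: cvg_snd.
  exact: ptwise_proj_continuous.
exact: cvgD h1 h2.
Qed.

Let ptwise_scale_continuous : continuous (fun z : R^o * E => z.1 *: z.2).
Proof.
apply: ptwise_continuous => i x.
have h1 : (fun x : R^o * E => x.1 : R^o) @ x --> (x.1 : R^o) by exact: cvg_fst.
have h2 : (fun x : R^o * E => x.2 i : R^o) @ x --> (x.2 i : R^o).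
  apply: (@continuous_comp _ _ _ snd (fun f : E => f i : R^o)).
    exact: cvg_snd.
  exact: ptwise_proj_continuous.
exact: cvgM h1 h2.
Qed.

Let ptwise_locally_convex :
  exists2 B : set_system E, (forall b, b \in B -> convex_set b) & basis B.
Proof.
exists [set b | open b /\ convex_set b]; first by move=> b /[!inE] -[].
split=> [b []//|x].
(* Once the open convex sets around [x] are known to generate a filter, its convergence to [x] can
   be checked one coordinate at a time, where local convexity of [R] applies. *)
have FF : Filter (filter_from
    [set U | [set b : set E | open b /\ convex_set b] U /\ U x] id).
  apply: filter_from_filter.
    exists setT; split=> //; split; first exact: openT.
    by move=> ? ? ? _ _; rewrite inE.
  move=> A B [[oA cA] Ax] [[oB cB] Bx]; exists (A `&` B) => //; split=> //.
  split; first exact: openI.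
  by move=> y z t /[!inE] -[Ay By] [Az Bz]; split; apply/set_mem;
    [apply: cA|apply: cB]; exact/mem_set.
have [B convB [openB basisB]] := @locally_convex R R^o.
apply/ptwise_cvgP => i V /basisB[b [Bb bx] bV].
exists ((fun f : E => f i) @^-1` b); last by move=> f /= /bV.
split=> //; split.
  apply: open_comp; last exact: openB.
  by move=> ? _; exact: ptwise_proj_continuous.
move=> y z t /[!inE]/= yb zb; apply: set_mem.
by apply: (convB b (mem_set Bb) (y i) (z i) t); exact: mem_set.
Qed.

HB.instance Definition _ := PreTopologicalNmodule_isTopologicalNmodule.Build
  E ptwise_add_continuous.
HB.instance Definition _ := TopologicalNmodule_isTopologicalLmodule.Build
  R E ptwise_scale_continuous.
HB.instance Definition _ := Uniform_isTvs.Build R E ptwise_locally_convex.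

End ptwise_tvs.

(** * Means *)

Section Means.
Variables (R : realType) (T : Type).
Implicit Types (D : set (T -> R)) (f g : T -> R).
Local Notation E := (ptwise R (T -> R)).

Definition bounded_functions : set (T -> R) :=
  [set f | exists M, forall x, `|f x| <= M].

Record test_space D : Prop := {
  test_bounded : D `<=` bounded_functions ;
  test1 : D (fun=> 1) ;
  testD : forall f g, D f -> D g -> D (fun x => f x + g x) ;
  testZ : forall (a : R) f, D f -> D (fun x => a * f x)
}.

(* The value [0] outside [D] makes a mean on [D] determined by its values on
   [D], so that the means form a compact set of [E]. *)
Record mean_on D (mu : E) : Prop := {
  mean_junk : forall f, ~ D f -> mu f = 0 ;
  meanD : forall f g, D f -> D g -> mu (fun x => f x + g x) = mu f + mu g ;
  meanZ : forall (a : R) f, D f -> mu (fun x => a * f x) = a * mu f ;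
  mean_ge0 : forall f, D f -> (forall x, 0 <= f x) -> 0 <= mu f ;
  mean1 : mu (fun=> 1) = 1
}.

Lemma bounded_test_space : test_space bounded_functions.
Proof.
split=> //.
- by exists 1 => x; rewrite normr1.
- move=> f g [M fM] [N gN]; exists (M + N) => x.
  exact: le_trans (ler_normD _ _) (lerD _ _).
- move=> a f [M fM]; exists (`|a| * M) => x.
  by rewrite normrM ler_wpM2l.
Qed.

Variable D : set (T -> R).
Hypothesis DP : test_space D.

Lemma testB f g : D f -> D g -> D (fun x => f x - g x).
Proof.
move=> Df Dg; have := testD DP Df (testZ DP (-1) Dg).
by under eq_fun do rewrite mulN1r.
Qed.

Lemma test_cst (a : R) : D (fun=> a).
Proof. by have := testZ DP a (test1 DP); under eq_fun do rewrite mulr1. Qed.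

Section OneMean.
Variable mu : E.
Hypothesis muP : mean_on D mu.

Lemma meanB f g : D f -> D g -> mu (fun x => f x - g x) = mu f - mu g.
Proof.
move=> Df Dg; rewrite -mulN1r -(meanZ muP) // -(meanD muP) //.
  by congr (mu _); apply/funext => x; rewrite mulN1r.
exact: testZ.
Qed.

Lemma mean_cst (a : R) : mu (fun=> a) = a.
Proof.
rewrite -[RHS]mulr1 -(mean1 muP) -(meanZ muP); last exact: test1.
by congr (mu _); apply/funext => x; rewrite mulr1.
Qed.

Lemma le_mean f g : D f -> D g -> (forall x, f x <= g x) -> mu f <= mu g.
Proof.
move=> Df Dg fg; rewrite -subr_ge0 -meanB //.
by apply: (mean_ge0 muP) => [|x]; [exact: testB|rewrite subr_ge0].
Qed.

Lemma mean_norm_le f M : D f -> (forall x, `|f x| <= M) -> `|mu f| <= M.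
Proof.
move=> Df fM; have fMN x : - M <= f x <= M by rewrite -ler_norml.
rewrite ler_norml; apply/andP; split.
  rewrite -[leLHS]mean_cst; apply: le_mean => [||x] //; first exact: test_cst.
  by have /andP[] := fMN x.
rewrite -[leRHS]mean_cst; apply: le_mean => [||x] //; first exact: test_cst.
by have /andP[] := fMN x.
Qed.

End OneMean.

Let proj_cont f : continuous (fun mu : E => mu f : R).
Proof. exact: ptwise_proj_continuous. Qed.

Let closed_agree (u v : E -> R) : continuous u -> continuous v ->
  closed [set mu | u mu = v mu].
Proof.
move=> cu cv.
have -> : [set mu | u mu = v mu] = (fun mu => u mu - v mu) @^-1` [set 0].
  by apply/seteqP; split=> mu /=; [move->; rewrite subrr|move/subr0_eq].
apply: preimage_closed; last exact: closed_eq.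
by move=> mu _; exact: cvgB (cu mu) (cv mu).
Qed.

Lemma closed_mean_on : closed (mean_on D).
Proof.
have -> : mean_on D =
  \bigcap_(f in ~` D) [set mu : E | mu f = 0] `&`
  \bigcap_(f in D) (\bigcap_(g in D)
    [set mu : E | mu (fun x => f x + g x) = mu f + mu g]) `&`
  \bigcap_(a in [set: R]) (\bigcap_(f in D)
    [set mu : E | mu (fun x => a * f x) = a * mu f]) `&`
  \bigcap_(f in D `&` [set f | forall x, 0 <= f x]) [set mu : E | 0 <= mu f] `&`
  [set mu : E | mu (fun=> 1) = 1].
  apply/seteqP; split=> mu.
    move=> [h1 h2 h3 h4 h5]; do !split => //.
    - by move=> f Df g Dg; exact: h2.
    - by move=> a _ f Df; exact: h3.
    - by move=> f [Df f0]; exact: h4.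
  move=> [[[[h1 h2] h3] h4] h5]; split=> //.
  - by move=> f g Df Dg; exact: h2.
  - by move=> a f Df; exact: h3.
  - by move=> f Df f0; exact: h4.
do ?apply: closedI.
- apply: closed_bigI => f _.
  pose h := closed_agree (@proj_cont f) (@cst_continuous _ _ (0 : R)).
  exact h.
- apply: closed_bigI => f _; apply: closed_bigI => g _.
  have h : continuous (fun mu : E => mu f + mu g : R).
    by move=> mu; exact: cvgD (@proj_cont f mu) (@proj_cont g mu).
  pose h' := closed_agree (@proj_cont (fun x => f x + g x)) h.
  exact h'.
- apply: closed_bigI => a _; apply: closed_bigI => f _.
  have h : continuous (fun mu : E => a * mu f : R).
    by move=> mu; exact: cvgM (cvg_cst a) (@proj_cont f mu).
  pose h' := closed_agree (@proj_cont (fun x => a * f x)) h.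
  exact h'.
- apply: closed_bigI => f _.
  have h : closed ((fun mu : E => mu f : R) @^-1` [set x | 0 <= x]).
    apply: preimage_closed; last exact: closed_ge.
    by move=> mu _; exact: proj_cont.
  exact h.
- pose h := closed_agree (@proj_cont (fun=> 1)) (@cst_continuous _ _ (1 : R)).
  exact h.
Qed.

(** Banach-Alaoglu in product form: a mean takes values in [[- M f, M f]] at each test function [f]
    and vanishes elsewhere, so the means form a closed subset of a Tychonoff product of compact
    sets. *)
Lemma compact_mean_on : compact (mean_on D).
Proof.
pose M f : R := xget 0 [set M | forall x, `|f x| <= M].
have MP f : D f -> forall x, `|f x| <= M f.
  by move=> /(test_bounded DP)[N fN]; rewrite /M; case: xgetP => // /(_ N).
pose A f : set R^o := if pselect (D f) then [set` `[- M f, M f]] else [set 0].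
apply: (@subclosed_compact _ _ [set mu : E | forall f, A f (mu f)]).
- exact: closed_mean_on.
- apply: (@tychonoff {classic (T -> R)} (fun=> R^o) A) => f; rewrite /A.
  by case: pselect => ?; [exact: segment_compact|exact: compact_set1].
- move=> mu muP f; rewrite /A; case: pselect => [Df|nDf]; last
    exact: mean_junk muP _ nDf.
  by rewrite /= in_itv/= -ler_norml; apply: mean_norm_le => //; exact: MP.
Qed.

Lemma mean_on_conv (mu nu : E) (t : R) : 0 <= t <= 1 ->
  mean_on D mu -> mean_on D nu ->
  mean_on D (fun f => t * mu f + (1 - t) * nu f).
Proof.
move=> /andP[t0 t1] [m1 m2 m3 m4 m5] [n1 n2 n3 n4 n5]; split.
- by move=> f Df; rewrite m1// n1// !mulr0 addr0.
- by move=> f g Df Dg; rewrite m2// n2// !mulrDr addrACA.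
- by move=> a f Df; rewrite m3// n3//; ring.
- by move=> f Df f0; rewrite addr_ge0// mulr_ge0// ?m4 ?n4 ?subr_ge0.
- by rewrite m5 n5 !mulr1 subrKC.
Qed.

End Means.

(** * Minimal ideals and extreme points *)

(** Zorn's lemma applied to complements in [C]; compactness keeps the intersection of a chain
    non-empty. It serves twice below, for closed left ideals and for closed faces. *)
Lemma exists_minimal_closed (T : topologicalType) (C : set T)
    (P : set (set T)) :
  compact C -> closed C -> C !=set0 -> P C ->
  (forall F, F !=set0 -> F `<=` P -> P (\bigcap_(A in F) A)) ->
  exists A, [/\ closed A, A !=set0, A `<=` C, P A &
    forall B, closed B -> B !=set0 -> P B -> B `<=` A -> B = A].
Proof.
move=> cptC clC C0 PC Pcap.
pose Q U := [/\ closed (C `&` ~` U), C `&` ~` U !=set0 & P (C `&` ~` U)].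
have [|U [[clU U0 PU] maxU]] := @Zorn_bigcup T Q.
  move=> F FQ totF.
  (* The empty chain also needs a bound; its candidate is [C] itself. *)
  have [->|/set0P[X0 FX0]] := eqVneq F set0.
    by rewrite bigcup_set0 /Q setC0 setIT.
  have capE : C `&` ~` (\bigcup_(X in F) X) =
      \bigcap_(A in [set C `&` ~` X | X in F]) A.
    rewrite setC_bigcup; apply/seteqP; split=> [x [Cx Fx] _ [X FX <-]|x Fx].
      by split=> //; exact: Fx.
    have [Cx _] : (C `&` ~` X0) x by apply: Fx; exists X0.
    by split=> // X FX; have [] : (C `&` ~` X) x by apply: Fx; exists X.
  split.
  - by rewrite capE; apply: closed_bigI => _ [X /FQ[? _ _] <-].
  (* The chain generates a proper filter on [C], and a cluster point of it lies in every closed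
     member. *)
  - have FF : ProperFilter (filter_from F (fun X => C `&` ~` X)).
      apply: filter_from_proper; last by move=> X /FQ[].
      apply: filter_from_filter; first by exists X0.
      move=> X Y FX FY; have [XY|YX] := totF _ _ FX FY.
        by exists Y => // x [Cx nYx]; do !split => //; move=> /XY.
      by exists X => // x [Cx nXx]; do !split => //; move=> /YX.
    have [|x [Cx Fx]] := cptC _ FF; first by exists X0 => // x [].
    exists x; rewrite capE => _ [X FX <-]; have [clX _ _] := FQ _ FX.
    by apply: clX => V Vx; apply: Fx => //; exists X.
  - rewrite capE; apply: Pcap; first by exists (C `&` ~` X0); exists X0.
    by move=> _ [X /FQ[_ _ ?] <-].
exists (C `&` ~` U); split=> // B clB B0 PB BU; apply: contrapT => nBU.
have BC : C `&` ~` ~` B = B by rewrite setCK; apply/setIidr => x /BU[].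
apply: (maxU (~` B)); last by rewrite /Q BC.
rewrite properEneq; split; last by move=> x Ux /BU[_].
by apply/eqP => UB; apply: nBU; rewrite UB BC.
Qed.

(** * Convolution of means on a group *)

Section Convolution.
Variables (R : realType) (G : groupType).
Local Notation E := (ptwise R (G -> R)).
Implicit Types (mu nu q : E) (f : G -> R).

Definition mean : set E := mean_on (@bounded_functions R G).

Lemma bounded_translate f (g : G) :
  bounded_functions (fun x => f (g * x)%g) <-> bounded_functions f.
Proof.
split=> -[M fM]; exists M => x; last exact: fM.
by rewrite -(mulVKg g x); exact: fM.
Qed.

(** The mixture, weighted by [mu], of the translates by [c] of [nu c]. A constant family gives
    convolution; a varying one is needed for [conv_dominates_invariant]. *)
Lemma mean_mix mu (nu : G -> E) : mean mu -> (forall c, mean (nu c)) ->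
  mean (fun f => mu (fun c => nu c (fun x => f (c * x)%g))).
Proof.
move=> muP nuP.
have bd f : bounded_functions f ->
    bounded_functions (fun c => nu c (fun x => f (c * x)%g)).
  move=> [M fM]; exists M => c.
  apply: (mean_norm_le (bounded_test_space R G) (nuP c)) => [|x]; last first.
    exact: fM.
  by exists M => x; exact: fM.
split.
- move=> f nf; rewrite [X in mu X](_ : _ = fun=> 0).
    exact: (mean_cst (bounded_test_space R G) muP).
  apply/funext => c; apply: (mean_junk (nuP c)).
  by move=> /bounded_translate.
- move=> f g bf bg; rewrite -(meanD muP); [|exact: bd..].
  congr (mu _); apply/funext => c.
  by rewrite -(meanD (nuP c)) //; exact/bounded_translate.
- move=> a f bf; rewrite -(meanZ muP); last exact: bd.
  congr (mu _); apply/funext => c.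
  by rewrite -(meanZ (nuP c)) //; exact/bounded_translate.
- move=> f bf f0; apply: (mean_ge0 muP); first exact: bd.
  by move=> c; apply: (mean_ge0 (nuP c)); [exact/bounded_translate|].
- rewrite [X in mu X](_ : _ = fun=> 1); first exact: mean1 muP.
  by apply/funext => c; exact: mean1 (nuP c).
Qed.

(** The Arens product, which extends the multiplication of [G] from point masses to means. *)
Definition conv mu nu : E := fun f => mu (fun c => nu (fun x => f (c * x)%g)).

Lemma conv_mean mu nu : mean mu -> mean nu -> mean (conv mu nu).
Proof. by move=> muP nuP; exact: (mean_mix muP (fun=> nuP)). Qed.

Lemma convA mu nu q : conv mu (conv nu q) = conv (conv mu nu) q.
Proof.
apply/funext => f; congr (mu _); apply/funext => c; congr (nu _).
by apply/funext => d; congr (q _); apply/funext => x; rewrite mulgA.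
Qed.

(** Evaluating [conv mu q] at [f] amounts to evaluating [mu] at a function that does not depend on
    [mu]. Hence the left ideal generated by [q] is compact. *)
Lemma continuous_convr q : continuous (conv ^~ q : E -> E).
Proof. by apply: ptwise_continuous => f; exact: ptwise_proj_continuous. Qed.

Definition left_ideal (A : set E) : Prop :=
  forall mu nu, mean mu -> A nu -> A (conv mu nu).

(** For [q] in a minimal closed left ideal [A], the set of all [conv mu q] is a closed left ideal
    inside [A], hence equals [A]. *)
Lemma exists_minimal_left_ideal : mean !=set0 ->
  exists A : set E, [/\ A `<=` mean, A !=set0, compact A &
    forall q, A q -> A = [set conv mu q | mu in mean]].
Proof.
move=> mean0; have cptM := compact_mean_on (bounded_test_space R G).
have clM := @closed_mean_on R G (@bounded_functions R G).
have [|F F0 Fideal mu nu muP Fnu A FA|A [clA A0 AM Aideal Amin]] :=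
  exists_minimal_closed cptM clM mean0 (P := left_ideal).
- by move=> mu nu; exact: conv_mean.
- by apply: Fideal => //; exact: Fnu.
exists A; split=> //; first exact: subclosed_compact cptM AM.
move=> q Aq; apply/esym/Amin => [|||_ [mu muP <-]]; last exact: Aideal.
- apply: compact_closed; first exact: ptwise_hausdorff.
  apply: continuous_compact => //.
  by apply: continuous_subspaceT; exact: continuous_convr.
- by have [mu muP] := mean0; exists (conv mu q); exists mu.
- move=> mu _ muP [nu nuP <-]; exists (conv mu nu); first exact: conv_mean.
  by rewrite convA.
Qed.

(** The Krein-Milman argument: a minimal closed face of [C] is reduced to one point, and this point
    is extreme. *)
Lemma exists_extreme_point (C : set E) : compact C -> C !=set0 ->
  exists2 e, C e & forall a b (s : R), C a -> C b -> 0 < s < 1 ->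
    e = (fun f => s * a f + (1 - s) * b f) -> a = e.
Proof.
move=> cptC C0.
pose face (A : set E) := forall a b (s : R), C a -> C b -> 0 < s < 1 ->
  A (fun f => s * a f + (1 - s) * b f) -> A a /\ A b.
have clC : closed C by apply: compact_closed => //; exact: ptwise_hausdorff.
have [//|F F0 Fface a b s Ca Cb s01 Fab|A [clA A0 AC Aface Amin]] :=
  exists_minimal_closed cptC clC C0 (P := face).
  by split=> A FA; have [] := Fface _ FA _ _ _ Ca Cb s01 (Fab _ FA).
have cptA : compact A by exact: subclosed_compact cptC AC.
suff AE a e : A a -> A e -> a = e.
  have [e Ae] := A0; exists e; first exact: AC.
  move=> a b s Ca Cb s01 eE; apply: AE => //.
  by have [] : A a /\ A b by apply: (Aface a b s) => //; rewrite -eE.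
(* The points of [A] where evaluation at [f] is maximal form a closed face. *)
move=> Aa Ae; apply/funext => f.
have cf : continuous (fun mu : E => mu f : R) by exact: ptwise_proj_continuous.
have [z /set_mem Az zmax] := compact_EVT_max A0 cptA (continuous_subspaceT cf).
have {}zmax y : A y -> y f <= z f by move=> Ay; apply: zmax; exact: mem_set.
suff AzE : A `&` [set y | y f = z f] = A.
  have [[_ /= ->] [_ /= ->]] : (A `&` [set y | y f = z f]) a /\
    (A `&` [set y | y f = z f]) e by rewrite AzE.
  by [].
apply: Amin.
- have clz : closed ((fun y : E => y f : R) @^-1` [set z f]).
    by apply: preimage_closed; [move=> y _; exact: cf|exact: closed_eq].
  exact: closedI clA clz.
- by exists z.
- move=> a' b s Ca' Cb s01 [Aab /= abf].
  have [Aa' Ab] := Aface _ _ _ Ca' Cb s01 Aab.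
  (* Both values at [f] are at most [z f], and a combination of them with positive weights equals
     [z f], so both are maximal. *)
  have := zmax _ Aa'; have := zmax _ Ab; have /andP[s0 s1] := s01.
  by split; split=> //=; nra.
- by move=> y [].
Qed.

(** Quantifying over all [f] is harmless: a mean vanishes outside its test space, and the test
    spaces in use are stable under translation. *)
Definition left_inv (g : G) mu : Prop :=
  forall f, mu (fun x => f (g * x)%g) = mu f.

Lemma conv_left_inv g mu q : left_inv g mu -> left_inv g (conv mu q).
Proof.
move=> gmu f; rewrite /conv -(gmu (fun c => q (fun x => f (c * x)%g))).
congr (mu _); apply/funext => c; congr (q _); apply/funext => x.
by rewrite mulgA.
Qed.

Definition dominates_invariant (s : R) (g : G) mu : Prop :=
  exists mu1, [/\ mean mu1, left_inv g mu1 &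
    forall f, bounded_functions f -> (forall x, 0 <= f x) -> s * mu1 f <= mu f].

(** Since [c * g ^ c = g * c], translating a [g ^ c]-invariant mean by [c] makes it [g]-invariant.
    The [mu]-mixture of these translates is the invariant mean dominated by the convolution. *)
Lemma conv_dominates_invariant (s : R) (g : G) mu nu :
  mean mu -> mean nu ->
  (forall c, dominates_invariant s (g ^ c)%g nu) ->
  dominates_invariant s g (conv mu nu).
Proof.
move=> muP nuP /choice[nu1 nu1P].
have nu1M c : mean (nu1 c) by have [] := nu1P c.
exists (fun f => mu (fun c => nu1 c (fun x => f (c * x)%g))).
have mixP := mean_mix muP nu1M.
split=> // [f|f bf f0].
  congr (mu _); apply/funext => c; have [_ inv _] := nu1P c.
  rewrite -[RHS]inv; congr (nu1 c _); apply/funext => x; congr (f _).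
  by rewrite conjgE !mulgA mulgV mul1g.
have bT := bounded_test_space R G.
have bd (rho : G -> E) : (forall c, mean (rho c)) ->
    bounded_functions (fun c => rho c (fun x => f (c * x)%g)).
  have [M fM] := bf; move=> rhoP; exists M => c.
  apply: (mean_norm_le bT (rhoP c)) => [|x]; last exact: fM.
  exact/bounded_translate.
rewrite -(meanZ muP); last exact: bd.
apply: (le_mean bT muP) => [||c].
- by apply: (testZ bT); exact: bd.
- exact: (bd (fun=> nu)).
- have [_ _] := nu1P c; apply => //; exact/bounded_translate.
Qed.

(** The extreme point [e] of a minimal ideal is chosen before [g], so a single mean works for all
    [g] of positive weight. The strict bound [t g < 1] makes the decomposition of [e] a proper
    one. *)
Lemma exists_invariant_mean (t : G -> R) mu :
  (forall g c, t (g ^ c)%g = t g) -> (forall g, t g < 1) -> mean mu ->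
  (forall g, 0 < t g -> dominates_invariant (t g) g mu) ->
  exists2 e, mean e & forall g, 0 < t g -> left_inv g e.
Proof.
move=> tJ t1 muP mu_dom.
have [|Q [QM Q0 cptQ Qmin]] := exists_minimal_left_ideal; first by exists mu.
have [e Qe e_ext] := exists_extreme_point cptQ Q0.
have [q Qq] := Q0.
have Qmuq : Q (conv mu q) by rewrite (Qmin q Qq); exists mu.
(* By minimality [conv mu q] generates [Q], so [e] is the convolution of [conv nu mu] with [q]. *)
have [nu nuP eE] : [set conv nu (conv mu q) | nu in mean] e.
  by rewrite -Qmin.
have nu_dom g : 0 < t g -> dominates_invariant (t g) g (conv nu mu).
  move=> tg; apply: conv_dominates_invariant => // c.
  by rewrite -(tJ g c); apply: mu_dom; rewrite tJ.
have numuP := conv_mean nuP muP.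
have bT := bounded_test_space R G.
exists e; first exact: QM.
move=> g tg; have [mu1 [mu1P g_mu1 mu1_le]] := nu_dom g tg.
have tg1 : 0 < 1 - t g by rewrite subr_gt0.
(* The normalized remainder in [conv nu mu = t g * mu1 + (1 - t g) * mu2]; it is positive because
   [t g * mu1] is dominated. *)
pose mu2 : E := fun f => (1 - t g)^-1 * (conv nu mu f - t g * mu1 f).
have mu2P : mean mu2.
  split; rewrite /mu2.
  - by move=> f nf; rewrite (mean_junk numuP) // (mean_junk mu1P) //; ring.
  - by move=> f h bf bh; rewrite (meanD numuP) // (meanD mu1P) //; ring.
  - by move=> a f bf; rewrite (meanZ numuP) // (meanZ mu1P) //; ring.
  - move=> f bf f0; rewrite mulr_ge0 ?invr_ge0 ?(ltW tg1)// subr_ge0.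
    exact: mu1_le.
  - by rewrite (mean1 numuP) (mean1 mu1P) mulr1 mulVf // gt_eqF.
(* Convolving the decomposition with [q] on the right writes [e] as a combination of two points of
   [Q], and extremality identifies [e] with the first. *)
suff <- : conv mu1 q = e by exact: conv_left_inv.
apply: (e_ext _ (conv mu2 q) (t g)).
- by rewrite (Qmin q Qq); exists mu1.
- by rewrite (Qmin q Qq); exists mu2.
- by rewrite tg t1.
rewrite -eE convA; apply/funext => f; rewrite {2}/conv {2}/conv /mu2.
rewrite mulrA divff ?gt_eqF// mul1r.
by rewrite addrC subrK.
Qed.

End Convolution.

(** * Invariant means and amenability *)

Section Subgroups.
Variable G : groupType.
Implicit Types (H : set G).

Lemma subgroup1 H : is_subgroup H -> H 1%g.
Proof. by move=> [/set_mem]. Qed.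

Lemma subgroupV H x : is_subgroup H -> H x -> H x^-1%g.
Proof. by move=> /group_closedV HV Hx; apply/set_mem/HV/mem_set. Qed.

Lemma subgroupM H x y : is_subgroup H -> H x -> H y -> H (x * y)%g.
Proof. by move=> /group_closedM HM Hx Hy; apply/set_mem/HM; exact/mem_set. Qed.

Lemma is_subgroupP H : H 1%g -> (forall x, H x -> H x^-1%g) ->
  (forall x y, H x -> H y -> H (x * y)%g) -> is_subgroup H.
Proof.
move=> H1 HV HM; split=> [|x y /set_mem Hx /set_mem Hy]; apply/mem_set => //.
by apply: HM => //; exact: HV.
Qed.

Definition generated (S : set G) : set G :=
  [set x | forall H, is_subgroup H -> S `<=` H -> H x].

Lemma generated_subgroup S : is_subgroup (generated S).
Proof.
apply: is_subgroupP => [H HP _|x Sx H HP SH|x y Sx Sy H HP SH].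
- exact: subgroup1.
- by apply: subgroupV => //; exact: Sx.
- by apply: subgroupM => //; [exact: Sx|exact: Sy].
Qed.

(** If a subgroup [H] contains [S], so does its preimage under conjugation by [g], which is again a
    subgroup. *)
Lemma generated_normal (S : set G) : (forall g x, S x -> S (x ^ g)%g) ->
  is_normal_subgroup (generated S).
Proof.
move=> SJ; split=> [|g x Sx H HP SH]; first exact: generated_subgroup.
apply: (Sx [set y | H (y ^ g)%g]) => [|y Sy]; last by apply: SH; exact: SJ.
apply: is_subgroupP => /= [|y Hy|y z Hy Hz].
- by rewrite conj1g; exact: subgroup1.
- by rewrite conjVg; exact: subgroupV.
- by rewrite conjMg; exact: subgroupM.
Qed.

End Subgroups.

(** * Amenability from invariant means, and invariant means from co-amenability *)

Section InvariantMeans.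
Variables (R : realType) (G : groupType).
Local Notation E := (ptwise R (G -> R)).

(** The mean [e] is pushed forward to [N] along the left [N]-equivariant map [sigma], which divides
    each element by a chosen representative of its right coset. *)
Lemma invariant_mean_amenable (N : set G) (e : E) :
  is_subgroup N -> mean e -> (forall g, N g -> left_inv g e) -> amenable R N.
Proof.
move=> NP eP eN; have bT := bounded_test_space R G.
(* The choice is made from the set [N x], so [r] is constant on right cosets of [N]. *)
pose r x := xget 1%g [set y | N (y * x^-1)%g].
have rP x : N (x * (r x)^-1)%g.
  have : N (r x * x^-1)%g.
    apply: (@xgetPex _ _ [set y | N (y * x^-1)%g]); exists x.
    by rewrite /= mulgV; exact: subgroup1.
  by move=> /(subgroupV NP); rewrite invgM invgK.
have rM n x : N n -> r (n * x)%g = r x.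
  move=> Nn; congr (xget _ _); apply/seteqP; split=> y /=; rewrite invgM => Ny.
    by have := subgroupM NP Ny Nn; rewrite -!mulgA mulVg mulg1.
  by rewrite mulgA; apply: subgroupM => //; exact: subgroupV.
pose sigma x := (x * (r x)^-1)%g.
pose F (A : set G) x : R := \1_A (sigma x).
have bF A : bounded_functions (F A).
  by exists 1 => x; rewrite /F indicE; case: (_ \in _); rewrite ?normr1 ?normr0.
exists (fun A => e (F A)); split.
- by move=> A _; apply: (mean_ge0 eP).
- rewrite -[RHS](mean1 eP); congr (e _); apply/funext => x.
  by rewrite /F indicE mem_set //; exact: rP.
- move=> A B _ _ AB; rewrite -(meanD eP) //; congr (e _); apply/funext => x.
  rewrite /F !indicE in_setU.
  have := AB; move/seteqP => [+ _] => /(_ (sigma x)) AB0.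
  case: (boolP (sigma x \in A)); case: (boolP (sigma x \in B));
    rewrite ?addr0 ?add0r// => /set_mem Bx /set_mem Ax.
  by have := AB0 (conj Ax Bx).
- move=> g A Ng AN; have NV := subgroupV NP Ng.
  rewrite -[RHS](eN _ NV); congr (e _); apply/funext => x.
  rewrite /F !indicE; congr (nat_of_bool _)%:R.
  rewrite /sigma rM // -mulgA; apply/idP/idP => /set_mem.
    by move=> [y Ay yE]; apply/mem_set; rewrite -yE mulKg.
  move=> Ax; apply/mem_set.
  by exists (g^-1 * (x * (r x)^-1))%g; rewrite // mulVKg.
Qed.

Lemma left_inv_subgroup (e : E) : is_subgroup [set g | left_inv g e].
Proof.
apply: is_subgroupP => /= [f|g ge f|g h ge he f].
- by congr (e _); apply/funext => x; rewrite mul1g.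
- by rewrite -[LHS]ge; congr (e _); apply/funext => x; rewrite mulKg.
- rewrite -[RHS]ge -[RHS]he; congr (e _); apply/funext => x.
  by rewrite mulgA.
Qed.

Lemma trivial_radical_invariant_mean (S : set G) (e : E) :
  is_amenable_radical R [set 1%g : G] -> (forall g x, S x -> S (x ^ g)%g) ->
  mean e -> (forall g, S g -> left_inv g e) -> S `<=` [set 1%g].
Proof.
move=> [_ _ rad] SJ eP Se x Sx.
apply: (rad _ (generated_normal SJ)); last by move=> H _; apply.
apply: (invariant_mean_amenable (generated_subgroup S) eP) => g Sg.
exact: (Sg _ (left_inv_subgroup e) Se).
Qed.

(** Bounded functions on [G / L], lifted to [G] to avoid a quotient type. *)
Definition coset_functions (L : set G) : set (G -> R) :=
  [set f | bounded_functions f /\ forall x l, L l -> f (x * l)%g = f x].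

Lemma coset_test_space L : test_space (coset_functions L).
Proof.
have [bT b1 bD bZ] := bounded_test_space R G; split.
- by move=> f [].
- by split.
- move=> f g [bf fL] [bg gL]; split=> [|x l Ll]; first exact: bD.
  by rewrite fL// gL.
- by move=> a f [bf fL]; split=> [|x l Ll]; [exact: bZ|rewrite fL].
Qed.

Lemma coset_translate L (f : G -> R) g :
  coset_functions L (fun x => f (g * x)%g) <-> coset_functions L f.
Proof.
split=> -[bf fL]; (split=> [|x l Ll]; first exact/(bounded_translate f g)).
  by rewrite -{1}(mulVKg g x) -mulgA fL // mulVKg.
by rewrite mulgA (fL _ l).
Qed.

(** Co-amenability is applied to the translation action of [G] on the compact convex set of means on
    [G / L], where [L] fixes the point mass at the trivial coset. *)
Lemma coamenable_invariant_mean L : is_subgroup L -> coamenable R L ->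
  exists2 p : E, mean_on (coset_functions L) p & forall g, left_inv g p.
Proof.
move=> LP Lco; have cT := coset_test_space L.
pose a (g : G) (mu : E) : E := fun f => mu (fun x => f (g * x)%g).
(* The point mass at the coset [L], set to [0] off the test space as [mean_junk] requires. *)
pose d1 : E := fun f => if pselect (coset_functions L f) then f 1%g else 0.
have d1E f : coset_functions L f -> d1 f = f 1%g.
  by rewrite /d1; case: pselect.
have d1P : mean_on (coset_functions L) d1.
  split.
  - by move=> f nf; rewrite /d1; case: pselect.
  - by move=> f g cf cg; rewrite !d1E //; exact: testD.
  - by move=> c f cf; rewrite !d1E //; exact: testZ.
  - by move=> f cf f0; rewrite d1E.
  - by rewrite d1E //; exact: test1.
have [||||||p [pP pfix]] := Lco E (mean_on (coset_functions L)) a.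
- exact: ptwise_hausdorff.
- by exists d1.
- exact: compact_mean_on.
- move=> mu nu t /set_mem muP /set_mem nuP; apply/mem_set.
  apply: (mean_on_conv _ muP nuP).
  by apply/andP; split.
- split.
  + move=> g mu [m1 m2 m3 m4 m5]; split; rewrite /a.
    * by move=> f nf; apply: m1 => /coset_translate.
    * by move=> f h cf ch; rewrite m2 //; exact/coset_translate.
    * by move=> c f cf; rewrite m3 //; exact/coset_translate.
    * by move=> f cf f0; rewrite m4 //; exact/coset_translate.
    * by [].
  + move=> mu _; apply/funext => f; congr (mu _); apply/funext => x.
    by rewrite mul1g.
  + move=> g h mu _; apply/funext => f; congr (mu _); apply/funext => x.
    by rewrite mulgA.
  + move=> g; apply: continuous_subspaceT; apply: ptwise_continuous => f.
    exact: ptwise_proj_continuous.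
  + by [].
- exists d1; split=> // l Ll; apply/funext => f; rewrite /a.
  have [cf|ncf] := pselect (coset_functions L f).
    rewrite !d1E //; last exact/coset_translate.
    by rewrite mulg1 -[l]mul1g cf.2.
  rewrite (mean_junk d1P ncf) (mean_junk d1P) // => /coset_translate //.
exists p => // g f; have := pfix g I; rewrite /a => /(congr1 (fun mu => mu f)).
exact.
Qed.

End InvariantMeans.

(** * Means carried by stabilizers *)

Section CountableMeasurability.
Variables (d : measure_display) (X : measurableType d) (I : choiceType).
Hypothesis cI : countable [set: I].

Lemma measurable_ex (F : I -> set X) : (forall i, measurable (F i)) ->
  measurable [set x | exists i, F i x].
Proof.
move=> mF; have -> : [set x | exists i, F i x] = \bigcup_i F i.
  by apply/seteqP; split=> x [i]; [exists i|exists i].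
exact: countable_bigcupT_measurable.
Qed.

Lemma measurable_all (F : I -> set X) : (forall i, measurable (F i)) ->
  measurable [set x | forall i, F i x].
Proof.
move=> mF; rewrite -[X in measurable X]setCK; apply: measurableC.
have -> : ~` [set x | forall i, F i x] = [set x | exists i, (~` F i) x].
  by apply/seteqP; split=> x; [move=> /existsNP|move=> ? /=; exact/existsNP].
by apply: measurable_ex => i; exact: measurableC.
Qed.

Lemma measurable_prop_and (P : Prop) (A : set X) : measurable A ->
  measurable [set x | P /\ A x].
Proof.
move=> mA; have [HP|nP] := pselect P.
  by rewrite (_ : [set x | _] = A) //; apply/seteqP; split=> x // [].
by rewrite (_ : [set x | _] = set0) //; apply/seteqP; split=> x // [].
Qed.

Lemma measurable_prop_imply (P : Prop) (A : set X) : measurable A ->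
  measurable [set x | P -> A x].
Proof.
move=> mA; have [HP|nP] := pselect P.
  by rewrite (_ : [set x | _] = A) //; apply/seteqP; split=> x /=; [apply|].
rewrite (_ : [set x | _] = setT); first exact: measurableT.
by apply/seteqP; split=> x // _ /nP.
Qed.

End CountableMeasurability.

(** * Stabilizers and regular points *)

Section StabilizerMeans.
Variables (R : realType) (G : groupType) (L : set G).
Variables (d : measure_display) (X : measurableType d) (m : probability X R).
Variable act : G -> X -> X.
Hypothesis cG : countable [set: G].
Hypothesis LP : is_subgroup L.
Hypothesis actP : pmp_action m act.
Hypothesis mfix : forall g, measurable (fixed_set act g).
Hypothesis Lfree : essentially_free m act L.
Local Notation fix_ := (fixed_set act).
Local Notation E := (ptwise R (G -> R)).

Lemma fixed1 x : fix_ 1%g x.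
Proof. exact: pmp_action1 actP x. Qed.

Lemma fixedM g h x : fix_ g x -> fix_ h x -> fix_ (g * h)%g x.
Proof. by rewrite /fixed_set /= (pmp_actionM actP) => gx ->. Qed.

Lemma fixedV g x : fix_ g x -> fix_ g^-1%g x.
Proof.
rewrite /fixed_set /= => gx.
by rewrite -{1}gx -(pmp_actionM actP) mulVg (pmp_action1 actP).
Qed.

Lemma fixed_conj g c : fix_ (g ^ c)%g = act c @^-1` fix_ g.
Proof.
apply/seteqP; split=> x; rewrite /fixed_set /= conjgE !(pmp_actionM actP).
  move=> /(congr1 (act c)).
  by rewrite -(pmp_actionM actP) mulgV (pmp_action1 actP).
by move=> ->; rewrite -(pmp_actionM actP) mulVg (pmp_action1 actP).
Qed.

Lemma measure_fixed_conj g c : m (fix_ (g ^ c)%g) = m (fix_ g).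
Proof. by rewrite fixed_conj (pmp_action_preserving actP). Qed.

(* The stabilizer of a regular point acts freely on [G / L]. *)
Definition regular : set X :=
  [set x | forall k, (k <> 1%g /\ exists r, L (k ^ r)%g) -> (~` fix_ k) x].

Lemma measurable_regular : measurable regular.
Proof.
apply: measurable_all => // k; apply: measurable_prop_imply.
exact: measurableC.
Qed.

(** If [k <> 1] has a conjugate in [L], that conjugate has a null fixed set, and invariance of [m]
    makes the fixed set of [k] null too. Countably many such [k] occur. *)
Lemma measure_regularC : m (~` regular) = 0%E.
Proof.
apply: measure_negligible; first exact/measurableC/measurable_regular.
have [u uinj] := countable_injP _ cG.
pose bad k := k <> 1%g /\ exists r, L (k ^ r)%g.
(* By injectivity of [u], each [F n] is either empty or the fixed set of a single bad element. *)
pose F n := \bigcup_(k in [set k | u k = n /\ bad k]) fix_ k.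
apply: (@negligibleS _ _ _ _ (\bigcup_n F n)).
  move=> x /existsNP[k /not_implyP[bk /contrapT kx]].
  by exists (u k) => //; exists k.
apply: negligible_bigcup => n.
have [[k [ukn [k1 [r Lkr]]]]|nk] := pselect (exists k, u k = n /\ bad k).
  apply: (@negligibleS _ _ _ _ (fix_ k)).
    move=> x [k' [uk' _]]; rewrite (uinj k k') ?inE // uk'; exact: ukn.
  have mk0 : m (fix_ k) = 0%E.
    rewrite -(measure_fixed_conj k r); apply: Lfree => // kr1; apply: k1.
    by apply/eqP; rewrite -(conjg_eq1 _ r) kr1.
  exact/negligibleP.
apply: (@negligibleS _ _ _ _ set0); last exact: negligible_set0.
by move=> x [k [? ?] _]; apply: nk; exists k.
Qed.

Lemma measure_regularI S : measurable S -> m (S `&` regular) = m S.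
Proof.
move=> mS; have mX := measurable_regular.
have -> : m S = (m (S `\` regular) + m (S `&` regular))%E.
  exact: measureDI.
have -> : m (S `\` regular) = 0%E; last by rewrite add0e.
have reg0 := measure_regularC.
apply: (subset_measure0 _ _ _ reg0).
- exact: measurableD.
- exact: measurableC.
- by move=> x [].
Qed.

(** * Equivariant selectors from [G / L] to stabilizers *)

Section Selector.
Variable u : G -> nat.
Hypothesis uinj : injective u.

(** This is [Stab(x) c L], the preimage in [G] of the [Stab(x)]-orbit of [c L]. *)
Definition double_coset x (c : G) : set G :=
  [set r | exists k, L (c^-1 * k * r)%g /\ fix_ k x].

(** The element of least index under [u]: a choice that depends only on the double coset and is
    measurable in [x]. *)
Definition representative x (c r : G) : Prop :=
  double_coset x c r /\
  forall r', (u r' < u r)%N -> (~` [set x | double_coset x c r']) x.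

(* [h] is the element of the stabilizer of [x] that moves [r L] to [c L], where
   [r L] represents the orbit of [c L]; it is unique when [x] is regular. *)
Definition selected x (c h : G) : Prop :=
  fix_ h x /\ exists r, L (c^-1 * h * r)%g /\ representative x c r.

Lemma measurable_double_coset c r : measurable [set x | double_coset x c r].
Proof. by apply: measurable_ex => // k; exact: measurable_prop_and. Qed.

Lemma measurable_selected c h : measurable [set x | selected x c h].
Proof.
apply: measurableI => //; apply: measurable_ex => // r.
apply: measurable_prop_and; apply: measurableI.
  exact: measurable_double_coset.
apply: measurable_all => // r'; apply: measurable_prop_imply.
exact/measurableC/measurable_double_coset.
Qed.

Lemma double_cosetM x c k : fix_ k x ->
  double_coset x (k * c)%g = double_coset x c.
Proof.
have sub k' c' : fix_ k' x -> double_coset x c' `<=` double_coset x (k' * c')%g.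
  move=> k'x r [h [Lh hx]]; exists (k' * h)%g; split; last exact: fixedM.
  by rewrite invgM -!mulgA mulKg mulgA.
move=> kx; apply/seteqP; split; last exact: sub.
by rewrite -{2}(mulKg k c); apply: sub; exact: fixedV.
Qed.

Lemma double_coset_mulr x c l : L l ->
  double_coset x (c * l)%g = double_coset x c.
Proof.
have sub l' c' : L l' -> double_coset x c' `<=` double_coset x (c' * l')%g.
  move=> Ll' r [h [Lh hx]]; exists h; split=> //.
  by rewrite invgM -!mulgA; apply: subgroupM => //;
    [exact: subgroupV|rewrite mulgA].
move=> Ll; apply/seteqP; split; last exact: sub.
by rewrite -{2}(mulgK l c); apply: sub; exact: subgroupV.
Qed.

(** The double cosets of [c] and [k * c] agree, so they share the representative [r], and [k * h]
    moves [r L] to [k c L]. *)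
Lemma selectedM x c h k : fix_ k x -> selected x c h ->
  selected x (k * c)%g (k * h)%g.
Proof.
move=> kx [hx [r [Lr rr]]]; split; first exact: fixedM.
exists r; split; first by rewrite invgM -!mulgA mulKg mulgA.
by move: rr; rewrite /representative /= !double_cosetM.
Qed.

Lemma selected_mulr x c h l : L l -> selected x c h -> selected x (c * l)%g h.
Proof.
move=> Ll [hx [r [Lr rr]]]; split=> //; exists r; split.
  by rewrite invgM -!mulgA; apply: subgroupM => //;
    [exact: subgroupV|rewrite mulgA].
by move: rr; rewrite /representative /= !double_coset_mulr.
Qed.

Lemma selected_exists x c : exists h, selected x c h.
Proof.
have [r [[k [Lk kx]] rmin]] : exists r, representative x c r.
  pose Q n := `[< exists r, double_coset x c r /\ u r = n >].
  have Q0 : exists n, Q n.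
    exists (u c); apply/asboolP; exists c; split=> //; exists 1%g.
    by rewrite mulg1 mulVg; split; [exact: subgroup1|exact: fixed1].
  have [_ /asboolP[r [rr <-]] rmin] := ex_minnP Q0.
  exists r; split=> // r' r'r rr'.
  have /rmin : Q (u r') by apply/asboolP; exists r'.
  by rewrite leqNgt r'r.
by exists k; split=> //; exists r; split=> //; split=> //; exists k.
Qed.

(** The representative [r] is unique because [u] is injective. Then [h^-1 * h'] fixes both [x] and
    the coset [r L], so it is trivial by regularity. *)
Lemma selected_unique x c h h' : regular x ->
  selected x c h -> selected x c h' -> h = h'.
Proof.
move=> xreg [hx [r [Lr [rr rmin]]]] [h'x [r' [Lr' [rr' rmin']]]].
have rE : r' = r.
  apply: uinj; apply/eqP; rewrite eqn_leq; apply/andP; split; rewrite leqNgt.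
    by apply/negP => /rmin' /(_ rr).
  by apply/negP => /rmin /(_ rr').
rewrite {}rE {r' rr' rmin'} in Lr'.
have [->|hh'] := eqVneq h h'; first by [].
have := xreg (h^-1 * h')%g.
have -> : (~` fix_ (h^-1 * h')%g) x = False.
  by apply/propext; split=> //; apply; apply: fixedM => //; exact: fixedV.
case; split.
  by move/(congr1 (fun y => h * y)%g); rewrite mulVKg mulg1 => /esym/eqP;
    apply/negP.
exists r; rewrite conjgE.
have := subgroupM LP (subgroupV LP Lr) Lr'.
by rewrite !invgM invgK -!mulgA mulVKg.
Qed.

(** For regular [x] this is the [Stab(x)]-equivariant map from [G / L] to [Stab(x)]. The default [1]
    never arises, by [selected_exists]. *)
Definition selector x c : G := xget 1%g [set h | selected x c h].

Lemma selectorP x c : selected x c (selector x c).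
Proof. exact: xgetPex (selected_exists x c). Qed.

Lemma selector_eq x c h : regular x -> selected x c h -> selector x c = h.
Proof. by move=> xreg; apply: selected_unique => //; exact: selectorP. Qed.

Lemma selectorM x c k : regular x -> fix_ k x ->
  selector x (k * c)%g = (k * selector x c)%g.
Proof.
by move=> xreg kx; apply: selector_eq => //; apply: selectedM => //;
  exact: selectorP.
Qed.

Lemma selector_mulr x c l : regular x -> L l ->
  selector x (c * l)%g = selector x c.
Proof.
by move=> xreg Ll; apply: selector_eq => //; apply: selected_mulr => //;
  exact: selectorP.
Qed.

(** A preimage is the countable union, over the [h] with [f h] in the target set, of the sets where
    [h] is selected; uniqueness on regular points gives the equality. *)
Lemma measurable_selector (f : G -> R) c S : measurable S ->
  measurable_fun (S `&` regular) (fun x => f (selector x c)).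
Proof.
move=> mS _ B mB.
have -> : S `&` regular `&` (fun x => f (selector x c)) @^-1` B =
    [set x | exists h, B (f h) /\
      (S `&` regular `&` [set x | selected x c h]) x].
  apply/seteqP; split=> x.
    move=> [SX Bx]; exists (selector x c); split=> //; split=> //.
    exact: selectorP.
  by move=> [h [Bh [[Sx Xx] sel]]]; split=> //=; rewrite (selector_eq Xx sel).
apply: measurable_ex => // h; apply: measurable_prop_and.
apply: measurableI; last exact: measurable_selected.
by apply: measurableI => //; exact: measurable_regular.
Qed.

(** Restricting to regular points discards a null set and keeps the selector measurable and
    equivariant. *)
Definition average (S : set X) (f : G -> R) (c : G) : R :=
  \int[m]_(x in S `&` regular) f (selector x c).

Let mreg (S : set X) : measurable S -> measurable (S `&` regular).
Proof. by move=> mS; apply: measurableI => //; exact: measurable_regular. Qed.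

Let integrable_selector S (f : G -> R) c :
  measurable S -> bounded_functions f ->
  m.-integrable (S `&` regular) (EFin \o (fun x => f (selector x c))).
Proof.
move=> mS [M fM]; apply: measurable_bounded_integrable.
- exact: mreg.
- by apply: le_lt_trans (probability_le1 _ _) (ltry _); exact: mreg.
- exact: measurable_selector.
- exists M; split; first exact: num_real.
  by move=> N MN x _; exact: le_trans (fM _) (ltW MN).
Qed.

Lemma averageD S f g c : measurable S -> bounded_functions f ->
  bounded_functions g ->
  average S (fun x => f x + g x) c = average S f c + average S g c.
Proof.
by move=> mS bf bg; rewrite /average RintegralD //;
  [exact: mreg|exact: integrable_selector|exact: integrable_selector].
Qed.

Lemma averageZ S a f c : measurable S -> bounded_functions f ->
  average S (fun x => a * f x) c = a * average S f c.
Proof.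
by move=> mS bf; rewrite /average RintegralZl //;
  [exact: mreg|exact: integrable_selector].
Qed.

Lemma le_average S f g c : measurable S -> bounded_functions f ->
  bounded_functions g -> (forall x, f x <= g x) ->
  average S f c <= average S g c.
Proof.
move=> mS bf bg fg.
exact: (le_Rintegral (mreg mS) (integrable_selector c mS bf)
  (integrable_selector c mS bg)).
Qed.

Lemma average_ge0 S f c : (forall x, 0 <= f x) -> 0 <= average S f c.
Proof. by move=> f0; apply: Rintegral_ge0. Qed.

Lemma average_cst S a c : measurable S ->
  average S (fun=> a) c = a * fine (m S).
Proof.
move=> mS; rewrite /average Rintegral_cst; last exact: mreg.
by rewrite -(measure_regularI mS).
Qed.

Lemma averageS S f c : measurable S -> bounded_functions f ->
  (forall x, 0 <= f x) -> average S f c <= average setT f c.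
Proof.
move=> mS bf f0; rewrite /average.
have mSC := measurableC mS.
have -> : setT `&` regular = (S `&` regular) `|` (~` S `&` regular).
  by rewrite -setIUl setUv.
rewrite Rintegral_setU.
- by rewrite lerDl; exact: average_ge0.
- exact: mreg.
- exact: mreg.
- by rewrite -setIUl setUv; exact: integrable_selector.
- apply/disj_setPS => x [[Sx _] [nSx _]]; exact: nSx.
Qed.

(** This allows a mean on [G / L] to be applied to averages. A bound for [f] also bounds the average
    since [m S <= 1], and [L]-invariance comes from the selector. *)
Lemma average_coset S f : measurable S -> bounded_functions f ->
  coset_functions L (average S f).
Proof.
move=> mS bf; split.
  have [M fM] := bf; exists M => c; rewrite ler_norml.
  have M0 : 0 <= M by apply: le_trans (fM 1%g).
  have mS1 : fine (m S) <= 1.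
    rewrite -lee_fin fineK ?probability_le1 //.
    exact: fin_num_measure.
  have bM a : bounded_functions (fun _ : G => a) by exists `|a|.
  have mS0 : 0 <= fine (m S) by exact: fine_ge0.
  have fMN x : - M <= f x <= M by rewrite -ler_norml.
  apply/andP; split.
    apply: (@le_trans _ _ (average S (fun=> - M) c)).
      by rewrite average_cst //; nra.
    by apply: le_average => // x; have /andP[] := fMN x.
  apply: (@le_trans _ _ (average S (fun=> M) c)).
    by apply: le_average => // x; have /andP[] := fMN x.
  by rewrite average_cst //; nra.
move=> c l Ll; apply: eq_Rintegral => x /set_mem[_ xreg].
by rewrite selector_mulr.
Qed.

(** Every point of the domain of integration is fixed by [g], so equivariance of the selector
    applies to [g] at each of them. *)
Lemma average_fixed g f c :
  average (fix_ g) (fun x => f (g * x)%g) c = average (fix_ g) f (g * c)%g.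
Proof.
by apply: eq_Rintegral => x /set_mem[gx xreg]; rewrite selectorM.
Qed.

(** * Means on [G] averaged over points of [X] *)

Variable p : E.
Hypothesis pP : mean_on (coset_functions L) p.
Hypothesis p_inv : forall g, left_inv g p.

(** The image of [p] under the selectors, averaged over [x] in [S] and normalized by the mass of
    [S]. *)
Definition average_mean (S : set X) : E := fun f =>
  if pselect (bounded_functions f) then (fine (m S))^-1 * p (average S f)
  else 0.

Let average_meanE S f : bounded_functions f ->
  average_mean S f = (fine (m S))^-1 * p (average S f).
Proof. by rewrite /average_mean; case: pselect. Qed.

Lemma average_meanP S : measurable S -> 0 < fine (m S) -> mean (average_mean S).
Proof.
move=> mS S0; have [bT b1 bD bZ] := bounded_test_space R G.
have aP f : bounded_functions f -> coset_functions L (average S f).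
  exact: average_coset.
split.
- by move=> f nf; rewrite /average_mean; case: pselect.
- move=> f g bf bg; rewrite !average_meanE //; last exact: bD.
  rewrite -mulrDr -(meanD pP); [|exact: aP..].
  by congr (_ * p _); apply/funext => c; exact: averageD.
- move=> a f bf; rewrite !average_meanE //; last exact: bZ.
  rewrite mulrCA -(meanZ pP a (aP _ bf)).
  by congr (_ * p _); apply/funext => c; exact: averageZ.
- move=> f bf f0; rewrite average_meanE // mulr_ge0 //.
    by rewrite invr_ge0 ltW.
  by apply: (mean_ge0 pP) => [|c]; [exact: aP|exact: average_ge0].
- rewrite average_meanE // [X in p X](_ : _ = fun=> fine (m S)).
    by rewrite (mean_cst (coset_test_space R L) pP) mulVf // gt_eqF.
  by apply/funext => c; rewrite average_cst // mul1r.
Qed.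

Lemma average_mean_fixed g : left_inv g (average_mean (fix_ g)).
Proof.
move=> f; have [bf|nf] := pselect (bounded_functions f).
  rewrite !average_meanE //; last exact/bounded_translate.
  rewrite -[in RHS](p_inv g); congr (_ * p _); apply/funext => c.
  exact: average_fixed.
rewrite /average_mean; case: pselect => [/bounded_translate //|?].
by case: pselect.
Qed.

(** The factor [m (fix_ g)] cancels the normalization and leaves an integral over [fix_ g], which
    for non-negative [f] is at most the integral over [X]. The division by [2] leaves room for a
    weight below [1]. *)
Lemma average_mean_dominates g : 0 < fine (m (fix_ g)) ->
  dominates_invariant (fine (m (fix_ g)) / 2) g (average_mean setT).
Proof.
move=> g0; exists (average_mean (fix_ g)); split.
- exact: average_meanP.
- exact: average_mean_fixed.
move=> f bf f0; rewrite !average_meanE // probability_setT /= invr1 mul1r.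
rewrite mulrAC mulrA divff ?gt_eqF// mul1r.
have pg0 : 0 <= p (average (fix_ g) f).
  by apply: (mean_ge0 pP) => [|c]; [exact: average_coset|exact: average_ge0].
apply: (@le_trans _ _ (p (average (fix_ g) f))); first by lra.
apply: (le_mean (coset_test_space R L) pP) => [||c].
- exact: average_coset.
- exact: average_coset.
- exact: averageS.
Qed.

End Selector.
End StabilizerMeans.

Theorem mainTheorem11 (R : realType) (Gamma : groupType) (Lambda : set Gamma)
    (d : measure_display) (X : measurableType d) (m : probability X R)
    (act : Gamma -> X -> X)
    (Gamma_countable : countable [set: Gamma])
    (Gamma_trivial_radical : is_amenable_radical R [set 1%g : Gamma])
    (Lambda_subgroup : is_subgroup Lambda)
    (Lambda_coamenable : coamenable R Lambda)
    (act_pmp : pmp_action m act)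
    (act_fixed_measurable : forall g, measurable (fixed_set act g))
    (Lambda_free : essentially_free m act Lambda) :
  essentially_free m act [set: Gamma].
Proof.
have [p pP p_inv] :=
  coamenable_invariant_mean Lambda_subgroup Lambda_coamenable.
have [u u_inj] := countable_injP _ Gamma_countable.
have {}u_inj : injective u by move=> x y; apply: u_inj; rewrite inE.
(* Halving makes the weight [t g] different from [1]. *)
pose t (g : Gamma) : R := fine (m (fixed_set act g)) / 2.
have tP g : 0 < t g -> 0 < fine (m (fixed_set act g)) by rewrite /t => ?; lra.
have [|g|||e eP e_inv] := @exists_invariant_mean R Gamma t
    (average_mean Lambda m act u p setT).
- by move=> g c; rewrite /t (measure_fixed_conj act_pmp).
- have : fine (m (fixed_set act g)) <= 1.
    rewrite -lee_fin fineK ?probability_le1 //.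
    exact: fin_num_measure.
  by rewrite /t => ?; lra.
- apply: average_meanP => //.
  by rewrite probability_setT.
- by move=> g /tP g0; exact: average_mean_dominates.
move=> g _ g1; apply/eqP; rewrite eq_le measure_ge0 andbT leNgt.
apply/negP => mg.
apply: g1.
(* The elements of positive weight form a conjugation-invariant set and all fix [e], so the trivial
   radical leaves only the identity. *)
apply: (@trivial_radical_invariant_mean R Gamma [set g | 0 < t g] e) => //.
  by move=> h x; rewrite /= /t (measure_fixed_conj act_pmp).
by rewrite /= /t divr_gt0 // fine_gt0 // mg /= ltey_eq fin_num_measure.
Qed.
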